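(* For parameters $\epsilon,\theta,\tau,q\in\{0,1\}\subset\mathbb{F}_3$ let $\mathcal{L}(\epsilon,\theta,\tau,q)$ be the set $C_2\times C_3$ with the multiplication $$(\alpha,a)(\beta,b)=\big(\alpha+\beta,\ \alpha'\beta'\big(q+\epsilon(1+\theta)a+\tau b\big)+(1+\beta'\theta)a+b\big),\quad \alpha,\beta\in C_2,\ a,b\in C_3 .$$ Then $\mathcal{L}(\epsilon,\theta,\tau,q)$ is an Albert extension of $C_3$ by $C_2$, and the following hold. (1) Any loop of order six containing a subgroup of order three is isomorphic to an Albert extension $\mathcal{L}(\epsilon,\theta,\tau,q)$. (2) $\mathcal{L}(\epsilon,\theta,\tau,q)$ is commutative if and only if $\epsilon=\tau$ and $\theta=0$. (3) $\mathcal{L}(\epsilon,\theta,\tau,q)$ is either nuclear or it has precisely one of the left, middle or right nuclear properties. It is left, middle, or right nuclear if and only if $\epsilon=0$, $\epsilon=\tau$, or $\tau=0$, respectively. (4) $\mathcal{L}(\epsilon,\theta,\tau,q)$ is a group if and only if $\epsilon=\tau=0$ and $\theta q=0$.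
   Context: $C_2=\{0,1\}$ is the cyclic group of order two and $C_3$ is identified with the additive group of the field $\mathbb{F}_3$. For $\xi\in C_2=\{0,1\}$, $\xi'\in\mathbb{F}_3$ denotes the corresponding element $0$ or $1$ of $\mathbb{F}_3$; all arithmetic in the second coordinate is in $\mathbb{F}_3$. The left, middle and right nuclei of a loop $L$ are $\{u: ux\cdot y=u\cdot xy\ \forall x,y\}$, $\{u: xu\cdot y=x\cdot uy\ \forall x,y\}$ and $\{u: xy\cdot u=x\cdot yu\ \forall x,y\}$. The extension $\mathcal{L}(\epsilon,\theta,\tau,q)$ is called left (middle, right) nuclear if $\{0\}\times C_3$ is contained in its left (middle, right) nucleus, and nuclear if it is left, middle and right nuclear. For loops $K,N$ with identities $1_K,e$, an Albert extension of $N$ by $K$ is a loop on $K\times N$ with multiplication $(\alpha,a)(\beta,b)=(\alpha\beta,\triangledown_{\alpha,\beta}(a,b))$, where $\triangledown_{\alpha,\beta}$ are quasigroup multiplications on $N$ such that $\triangledown_{1_K,1_K}$ is the multiplication of $N$, $e$ is a left identity of $\triangledown_{1_K,\alpha}$ and $e$ is a two-sided identity of $\triangledown_{\alpha,1_K}$ for all $\alpha\in K$. Here $N=C_3$, $K=C_2$. *)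

(* Defs.v *)
From mathcomp Require Import all_boot all_order all_algebra.

Set Implicit Arguments.
Unset Strict Implicit.
Unset Printing Implicit Defensive.

Import GRing.Theory.
Local Open Scope ring_scope.

Section Loops.

Variable T : Type.
Implicit Types (mul : T -> T -> T) (e u : T).

Definition is_quasigroup mul : Prop :=
  (forall a b, exists! x, mul a x = b) /\ (forall a b, exists! y, mul y a = b).

Definition is_loop mul e : Prop :=
  [/\ is_quasigroup mul, left_id e mul & right_id e mul].

Definition is_group mul : Prop :=
  exists e, exists inv : T -> T,
    [/\ associative mul, left_id e mul, right_id e mul,
        left_inverse e inv mul & right_inverse e inv mul].

Definition left_nucleus mul u : Prop :=
  forall x y, mul (mul u x) y = mul u (mul x y).

Definition middle_nucleus mul u : Prop :=
  forall x y, mul (mul x u) y = mul x (mul u y).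

Definition right_nucleus mul u : Prop :=
  forall x y, mul (mul x y) u = mul x (mul y u).

End Loops.

(* A subset of the loop (T, mul, e) that is a group under the restriction of
   mul. Its neutral element is idempotent, hence equal to e. *)
Definition is_subgroup (T : finType) (mul : T -> T -> T) (e : T)
    (H : {set T}) : Prop :=
  [/\ e \in H,
      {in H &, forall x y, mul x y \in H},
      {in H & &, associative mul} &
      {in H, forall x, exists2 y, y \in H & mul x y = e /\ mul y x = e}].

Definition loop_isomorphic (T U : Type) (mulT : T -> T -> T)
    (mulU : U -> U -> U) : Prop :=
  exists2 f : T -> U, bijective f & {morph f : x y / mulT x y >-> mulU x y}.

(* Extension of (N, mulN, e) by (K, mulK, oneK). *)
Definition is_Albert_extension (K N : Type)
    (mulK : K -> K -> K) (oneK : K) (mulN : N -> N -> N) (e : N)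
    (mul : K * N -> K * N -> K * N) : Prop :=
  [/\ is_loop mulK oneK, is_loop mulN e, (exists one, is_loop mul one) &
      exists nabla : K -> K -> N -> N -> N,
        [/\ forall al be a b,
              mul (al, a) (be, b) = (mulK al be, nabla al be a b),
            forall al be, is_quasigroup (nabla al be),
            forall a b, nabla oneK oneK a b = mulN a b,
            forall al, left_id e (nabla oneK al) &
            forall al, left_id e (nabla al oneK) /\
                       right_id e (nabla al oneK)]].

Definition F01 : {set 'F_3} := [set 0; 1].

(* xi |-> xi', sending 0, 1 in C_2 to 0, 1 in F_3; it is not additive. *)
Definition lift23 (xi : 'Z_2) : 'F_3 := (nat_of_ord xi)%:R.

Definition Lmul (eps theta tau q : 'F_3) (x y : 'Z_2 * 'F_3) : 'Z_2 * 'F_3 :=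
  let: (al, a) := x in
  let: (be, b) := y in
  (al + be,
   lift23 al * lift23 be * (q + eps * (1 + theta) * a + tau * b)
     + (1 + lift23 be * theta) * a + b).

Section Nuclear.

Variable mul : 'Z_2 * 'F_3 -> 'Z_2 * 'F_3 -> 'Z_2 * 'F_3.

Definition left_nuclear : Prop := forall c : 'F_3, left_nucleus mul (0, c).
Definition middle_nuclear : Prop := forall c : 'F_3, middle_nucleus mul (0, c).
Definition right_nuclear : Prop := forall c : 'F_3, right_nucleus mul (0, c).
Definition nuclear : Prop := [/\ left_nuclear, middle_nuclear & right_nuclear].

End Nuclear.

Definition exactly_one (A B C : Prop) : Prop :=
  [\/ [/\ A, ~ B & ~ C], [/\ ~ A, B & ~ C] | [/\ ~ A, ~ B & C]].

(* Main.v *)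
Require Import Defs.
From mathcomp Require Import all_boot all_order all_algebra.
From mathcomp Require Import ring.

(* For (1), a subloop H of order three in a loop of order six has index two,
   so multiplication by H preserves its complement M and M * M = H. After
   choosing a bijection of F_3 with H, and with M by translating H by a point
   of M, the loop is described by four Latin squares of order three. Every
   such square is affine, (a, b) |-> w + u a + v b with u, v nonzero, because
   every permutation of F_3 is affine; the identity element leaves free only
   the sign t of the translations of M by H from the left and the parameters
   w, u, v of M * M -> H. Finally w = -1 is turned into w = 1 by inverting
   C_3. *)

Import GRing.Theory.
Local Open Scope ring_scope.

(** * Quasigroups and their translations *)

Lemma injective_quasigroup {T : finType} {mul : T -> T -> T} :
  (forall a, injective (mul a)) -> (forall b, injective (mul^~ b)) ->
  is_quasigroup mul.
Proof.
move=> injl injr; split=> a b.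
  have [g fK gK] := injF_bij (injl a); exists (g b); split=> [|x <-].
    exact: gK.
  exact: fK.
have [g fK gK] := injF_bij (injr a); exists (g b); split=> [|x <-].
  exact: gK.
exact: fK.
Qed.

Lemma quasigroup_injl {T : Type} {mul : T -> T -> T} :
  is_quasigroup mul -> forall a, injective (mul a).
Proof.
move=> [h _] a x y exy; have [z [_ u]] := h a (mul a x).
by rewrite -(u x) ?(u y).
Qed.

Lemma quasigroup_injr {T : Type} {mul : T -> T -> T} :
  is_quasigroup mul -> forall b, injective (mul^~ b).
Proof.
move=> [_ h] b x y exy; have [z [_ u]] := h b (mul x b).
by rewrite -(u x) ?(u y).
Qed.

Lemma affine_quasigroup {F : finFieldType} {u v : F} (w : F) :
  u != 0 -> v != 0 -> is_quasigroup (fun a b => w + u * a + v * b).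
Proof.
move=> u0 v0; apply: injective_quasigroup => [a x y /addrI|b x y /addIr/addrI];
  exact: mulfI.
Qed.

(** * Arithmetic and Latin squares over F_3 *)

Lemma Z2P (x : 'Z_2) : x = 0 \/ x = 1.
Proof. by case: x => [[|[|m]]] i //; [left | right]; apply: val_inj. Qed.

Lemma F3P (x : 'F_3) : [\/ x = 0, x = 1 | x = - 1].
Proof.
case: x => [[|[|[|m]]]] i //; [constructor 1 | constructor 2 | constructor 3];
  exact: val_inj.
Qed.

Lemma F01P (x : 'F_3) : x \in F01 -> x = 0 \/ x = 1.
Proof. by rewrite !inE => /orP[] /eqP; auto. Qed.

(** The units 1 and -1 of F_3 are exactly the elements 1 + x with x in {0, 1}; this is how the
    parameters encode slopes. *)
Lemma add1_F01 (u : 'F_3) : u != 0 -> u - 1 \in F01.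
Proof. by rewrite !inE; case: (F3P u) => ->. Qed.

Lemma add1_F01_neq0 (x : 'F_3) : x \in F01 -> 1 + x != 0.
Proof. by case/F01P => ->. Qed.

Lemma F3_sqr_neq0 (u : 'F_3) : u != 0 -> u * u = 1.
Proof. by case: (F3P u) => -> //; rewrite ?mulr1 // mulrNN mulr1. Qed.

(** Three distinct elements of F_3 sum to 0, so [f (- 1)] equals [- f 0 - f 1], the value at -1 of
    the affine map through the other two points. *)
Lemma F3_injective_affine (f : 'F_3 -> 'F_3) :
  injective f -> forall x, f x = f 0 + (f 1 - f 0) * x.
Proof.
move=> injf.
have d01 : f 0 != f 1 by rewrite (inj_eq injf).
have d02 : f 0 != f (- 1) by rewrite (inj_eq injf).
have d12 : f 1 != f (- 1) by rewrite (inj_eq injf).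
move=> x; case: (F3P x) => ->.
- by rewrite mulr0 addr0.
- by rewrite mulr1 addrC subrK.
apply/eqP; move: d01 d02 d12.
by case: (F3P (f 0)) => ->; case: (F3P (f 1)) => ->; case: (F3P (f (- 1))) => ->.
Qed.

(* Each row is affine; two rows with different slopes would meet in some
   column, so the slope is constant and the first column is affine too. *)
Lemma F3_latin_affine (m : 'F_3 -> 'F_3 -> 'F_3) :
  (forall a, injective (m a)) -> (forall b, injective (m^~ b)) ->
  exists w u v, [/\ u != 0, v != 0 & forall a b, m a b = w + u * a + v * b].
Proof.
move=> injl injr; pose s a := m a 1 - m a 0.
have rowE a b : m a b = m a 0 + s a * b by exact: F3_injective_affine.
have colE a : m a 0 = m 0 0 + (m 1 0 - m 0 0) * a.
  exact: (F3_injective_affine (m^~ 0)).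
have sE a : s a = s 0.
  apply/eqP; rewrite -subr_eq0; apply: contraT => ds.
  have a0 : a = 0.
    (* This is the column in which the rows [a] and [0] take the same value. *)
    apply: (injr ((m 0 0 - m a 0) / (s a - s 0))); rewrite /= !(rowE _ (_ / _)).
    by field.
  by rewrite a0 subrr eqxx in ds.
exists (m 0 0), (m 1 0 - m 0 0), (s 0); split=> [||a b].
- by rewrite subr_eq0 (inj_eq (injr 0)).
- by rewrite subr_eq0 (inj_eq (injl 0)).
- by rewrite rowE sE colE.
Qed.

(** * The lift of C_2 to F_3, and the extensions as affine quasigroups *)

Lemma lift0 : lift23 0 = 0. Proof. exact: val_inj. Qed.

Lemma lift1 : lift23 1 = 1. Proof. exact: val_inj. Qed.

Lemma lift_sqr al : lift23 al * lift23 al = lift23 al.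
Proof. by case: (Z2P al) => ->; apply: val_inj. Qed.

Lemma lift_mul_F01 al (x : 'F_3) : x \in F01 -> lift23 al * x \in F01.
Proof. by case: (Z2P al) => ->; rewrite ?lift1 ?mul1r // lift0 mul0r !inE. Qed.

(* The action of C_2 on C_3 is a homomorphism, although lift23 is not. *)
Lemma lift_character (theta : 'F_3) al be : theta \in F01 ->
  1 + lift23 (al + be) * theta = (1 + lift23 al * theta) * (1 + lift23 be * theta).
Proof.
by case/F01P => ->; case: (Z2P al) => ->; case: (Z2P be) => ->; apply: val_inj.
Qed.

(** The 2-cocycle identity, for the trivial action, of the map taking al, be to al' be'. *)
Lemma lift_cocycle al be ga :
  lift23 (al + be) * lift23 ga =
  lift23 al * lift23 (be + ga) + lift23 be * lift23 ga - lift23 al * lift23 be.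
Proof.
by case: (Z2P al) => ->; case: (Z2P be) => ->; case: (Z2P ga) => ->;
  apply: val_inj.
Qed.

(** The second coordinate of [Lmul] with the coefficient of [a] factored, using that be' is
    idempotent. Both slopes are then visibly units when the parameters lie in {0, 1}. *)
Definition nabla_affine (eps theta tau q : 'F_3) (al be : 'Z_2) (a b : 'F_3) :=
  lift23 al * lift23 be * q
    + (1 + lift23 al * lift23 be * eps) * (1 + lift23 be * theta) * a
    + (1 + lift23 al * lift23 be * tau) * b.

Lemma Lmul_affine eps theta tau q al be a b :
  Lmul eps theta tau q (al, a) (be, b) =
  (al + be, nabla_affine eps theta tau q al be a b).
Proof.
congr (_, _); rewrite /nabla_affine.
by case: (Z2P be) => ->; rewrite ?lift0 ?lift1; ring.
Qed.

Lemma nabla_affine_quasigroup eps theta tau q al be :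
  eps \in F01 -> theta \in F01 -> tau \in F01 ->
  is_quasigroup (nabla_affine eps theta tau q al be).
Proof.
move=> he ht hu; apply: affine_quasigroup; rewrite ?mulf_neq0 //;
  by apply: add1_F01_neq0; rewrite -?mulrA !lift_mul_F01.
Qed.

Lemma Lmul_Albert (eps theta tau q : 'F_3) :
  eps \in F01 -> theta \in F01 -> tau \in F01 ->
  is_Albert_extension (fun al be : 'Z_2 => al + be) 0
                      (fun a b : 'F_3 => a + b) 0 (Lmul eps theta tau q).
Proof.
move=> he ht hu.
have loopD (V : finZmodType) : is_loop (fun a b : V => a + b) 0.
  split; [|exact: add0r|exact: addr0].
  by apply: injective_quasigroup => [a | b]; [exact: addrI | exact: addIr].
have nq al be := nabla_affine_quasigroup eps theta tau q al be he ht hu.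
split; [exact: loopD | exact: loopD | exists (0, 0); split |].
- apply: injective_quasigroup => [[al a] [be b] [ga c] | [ga c] [al a] [be b]].
    rewrite !Lmul_affine => /pair_equal_spec[/addrI ->].
    by move/(quasigroup_injl (nq _ _)) ->.
  rewrite !Lmul_affine => /pair_equal_spec[/addIr ->].
  by move/(quasigroup_injr (nq _ _)) ->.
- by move=> [al a]; congr (_, _); rewrite ?add0r // lift0; ring.
- by move=> [al a]; congr (_, _); rewrite ?addr0 // lift0; ring.
exists (nabla_affine eps theta tau q); split=> // [al be a b|a b|al b|al].
- exact: Lmul_affine.
- by rewrite /nabla_affine lift0; ring.
- by rewrite /nabla_affine lift0; ring.
- by split=> b; rewrite /nabla_affine lift0; ring.
Qed.

(** * Loops of order six with a subgroup of order three *)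

Lemma F3_enumeration {T : finType} {H : {set T}} {e : T} :
  e \in H -> #|H| = 3%N ->
  exists p : 'F_3 -> T, [/\ p 0 = e, injective p & forall a, p a \in H].
Proof.
(* [e] heads the list so that index 0 is sent to it. *)
move=> eH cH; pose s := e :: enum (H :\ e).
have us : uniq s by rewrite /= enum_uniq mem_enum !inE eqxx.
have ss : size s = 3%N by rewrite /= -cardE; move: cH; rewrite (cardsD1 e) eH.
have lts (a : 'F_3) : (a < size s)%N by rewrite ss; exact: (ltn_ord a).
exists (fun a : 'F_3 => nth e s a); split=> // [a b /eqP|a].
  by rewrite nth_uniq // => /eqP/val_inj.
have := mem_nth e (lts a); rewrite inE mem_enum !inE.
by case/orP => [/eqP -> // | /andP[]].
Qed.

Lemma index2_subloop {T : finType} {mul : T -> T -> T} {e : T} {H : {set T}} :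
  is_loop mul e -> is_subgroup mul e H -> #|T| = (2 * #|H|)%N ->
  forall x y, (mul x y \in H) = ((x \in H) == (y \in H)).
Proof.
move=> [qg e1 e2] [eH closed _ _] cT.
have injl := quasigroup_injl qg; have injr := quasigroup_injr qg.
(* By finiteness, translations by elements of [H] permute [H]. Hence if a product and one of its
   factors lie in [H], so does the other factor. *)
have imH (f : T -> T) : injective f -> {in H, forall x, f x \in H} -> f @: H = H.
  move=> injf fH; apply/eqP; rewrite eqEcard card_imset // leqnn andbT.
  by apply/subsetP => _ /imsetP[x xH ->]; exact: fH.
have HM x y : x \in H -> mul x y \in H -> y \in H.
  move=> xH; rewrite -{1}(imH (mul x)) // => [/imsetP[z zH /injl -> //]|z].
  exact: closed.
have MH x y : y \in H -> mul x y \in H -> x \in H.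
  move=> yH; rewrite -{1}(imH (mul^~ y)) // => [/imsetP[z zH /injr -> //]|z zH].
  exact: closed.
move=> x y; case xH: (x \in H); case yH: (y \in H) => /=.
- exact: closed.
- by apply/negP => /(HM _ _ xH); rewrite yH.
- by apply/negP => /(MH _ _ yH); rewrite xH.
(* For [x] outside [H], the set [x H] misses [H] and has half the size of [T], so it fills the
   complement; a product [x y] outside [H] would then force [y] into [H]. *)
have imC : mul x @: H = ~: H.
  apply/eqP; rewrite eqEcard card_imset // cardsCs setCK cT.
  rewrite mul2n -addnn addnK leqnn andbT.
  apply/subsetP => _ /imsetP[z zH ->]; rewrite inE.
  by apply/negP => /(MH _ _ zH); rewrite xH.
apply: contraFT yH => xyH.
have : mul x y \in mul x @: H by rewrite imC inE.
by case/imsetP => z zH /injl ->.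
Qed.

(* The second factor of the chart is any bijection of C_3 with H fixing the
   identity: multiplicativity comes for free from [F3_latin_affine]. *)
Lemma affine_chart {T : finType} {mul : T -> T -> T} {e : T} {H : {set T}} :
  is_loop mul e -> #|T| = 6%N -> is_subgroup mul e H -> #|H| = 3%N ->
  exists (g : 'Z_2 * 'F_3 -> T) (t w u v : 'F_3),
  [/\ bijective g, [/\ t != 0, u != 0 & v != 0],
      forall be a b, mul (g (0, a)) (g (be, b)) =
        g (be, (if be == 0 then 1 else t) * a + b),
      forall a b, mul (g (1, a)) (g (0, b)) = g (1, a + b) &
      forall a b, mul (g (1, a)) (g (1, b)) = g (0, w + u * a + v * b)].
Proof.
move=> lp cT sg cH; have [qg e1 e2] := lp; have [eH _ _ _] := sg.
have par : forall x y, (mul x y \in H) = ((x \in H) == (y \in H)).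
  by apply: index2_subloop lp sg _; rewrite cT cH.
have injl := quasigroup_injl qg; have injr := quasigroup_injr qg.
have [p [p0 injp pH]] := F3_enumeration eH cH.
have [x0 x0H] : exists x0, x0 \notin H.
  have : (0 < #|~: H|)%N by rewrite cardsCs setCK cT cH.
  by case/card_gt0P => x0; rewrite inE => ?; exists x0.
pose g (x : 'Z_2 * 'F_3) := if x.1 == 0 then p x.2 else mul x0 (p x.2).
have gH x : (g x \in H) = (x.1 == 0).
  by rewrite /g; case: ifP => _; rewrite ?pH // par pH (negPf x0H).
have injg : injective g.
  move=> [al a] [be b] E; have := gH (al, a); rewrite E gH /= => Eab.
  have {}Eab : be = al.
    by move: Eab; case: (Z2P al) => ->; case: (Z2P be) => ->.
  move: E; rewrite Eab /g /=; case: ifP => _; first by move/injp ->.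
  by move/injl/injp ->.
have bijg : bijective g.
  apply: inj_card_bij => //; rewrite cT card_prod card_ord.
  by rewrite card_Fp.
have [f gK fK] := bijg.
pose n al be a b := (f (mul (g (al, a)) (g (be, b)))).2.
have nE al be a b : mul (g (al, a)) (g (be, b)) = g (al + be, n al be a b).
  rewrite -[LHS]fK; congr g; rewrite /n.
  (* The first coordinate records membership in [H], so [par] says that first coordinates add in
     C_2. *)
  have := par (g (al, a)) (g (be, b)); rewrite -[X in X \in _]fK !gH /=.
  case: (f _) => ga c /=.
  by case: (Z2P al) => ->; case: (Z2P be) => ->; case: (Z2P ga) => -> //= _;
    congr (_, _); apply: val_inj.
have n_affine al be : exists w u v,
    [/\ u != 0, v != 0 & forall a b, n al be a b = w + u * a + v * b].
  apply: F3_latin_affine => [a b c E | b a c E].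
    suff /injg/pair_equal_spec[] : g (be, b) = g (be, c) by [].
    by apply: (injl (g (al, a))); rewrite !nE E.
  suff /injg/pair_equal_spec[] : g (al, a) = g (al, c) by [].
  by apply: (injr (g (be, b))); rewrite /= !nE E.
(* Since [g (0, 0)] is the identity, it fixes row 0 of [n 0 be] and column 0 of [n al 0]. *)
have n0 be b : n 0 be 0 b = b.
  have /injg/pair_equal_spec[] // : g (be, n 0 be 0 b) = g (be, b).
  by rewrite -{1}[be]add0r -nE {1}/g /= p0 e1.
have n00 a : n 0 0 a 0 = a.
  have /injg/pair_equal_spec[] // : g (0, n 0 0 a 0) = g (0, a).
  by rewrite -{1}[0 : 'Z_2]add0r -nE {2}/g /= p0 e2.
have n10 a : n 1 0 a 0 = a.
  have /injg/pair_equal_spec[] // : g (1, n 1 0 a 0) = g (1, a).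
  by rewrite -{1}[1 : 'Z_2]addr0 -nE {2}/g /= p0 e2.
(* This one comes from the choice of [g] on the complement: [g (1, b)] is [x0] times [p b]. *)
have n10' b : n 1 0 0 b = b.
  have /injg/pair_equal_spec[] // : g (1, n 1 0 0 b) = g (1, b).
  by rewrite -{1}[1 : 'Z_2]addr0 -nE /g /= p0 e2.
(* An affine square is determined by row 0 and column 0, so [n 0 0] and [n 1 0] are forced to be
   addition. *)
have axes al be a b : n al be a b = n al be a 0 + n al be 0 b - n al be 0 0.
  by have [w [u [v [_ _ E]]]] := n_affine al be; rewrite !E; ring.
have [w1 [t [v1 [t0 _ E01]]]] := n_affine 0 1.
have [w [u [v [u0 v0 E11]]]] := n_affine 1 1.
exists g, t, w, u, v; split=> // [be a b|a b|a b].
- rewrite nE add0r; congr (g (_, _)); case: (Z2P be) => -> /=.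
    by rewrite axes n00 !n0; ring.
  have w10 : w1 = 0 by have := n0 1 0; rewrite E01 !mulr0 !addr0.
  by rewrite axes !n0 E01 w10; ring.
- by rewrite nE addr0 axes n10 !n10' subr0.
- by rewrite nE E11; congr (g (_, _)); apply: val_inj.
Qed.

Lemma order6_loop_Lmul {T : finType} {mul : T -> T -> T} {e : T} {H : {set T}} :
  is_loop mul e -> #|T| = 6%N -> is_subgroup mul e H -> #|H| = 3%N ->
  exists eps theta tau q : 'F_3,
    [/\ eps \in F01, theta \in F01, tau \in F01 & q \in F01] /\
    loop_isomorphic mul (Lmul eps theta tau q).
Proof.
move=> lp cT sg cH.
have [g [t [w [u [v [bijg [t0 u0 v0] g0 g10 g11]]]]]] :=
  affine_chart lp cT sg cH.
(* Inverting C_3 replaces w by - w and keeps t, u, v. *)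
have [s [ss sw]] : exists s : 'F_3, s * s = 1 /\ s * w \in F01.
  case: (F3P w) => ->; [exists 1 | exists 1 | exists (- 1)];
  by rewrite ?mulrNN ?mulr1 ?mul1r // !inE.
have tt := F3_sqr_neq0 _ t0.
(* Matching slopes requires 1 + theta = t, (1 + eps)(1 + theta) = u and 1 + tau = v, where t is its
   own inverse. *)
exists (u * t - 1), (t - 1), (v - 1), (s * w).
split; first by split=> //; rewrite add1_F01 // mulf_neq0.
pose sc (z : 'Z_2 * 'F_3) := (z.1, s * z.2).
have scK : involutive sc by case=> al a; rewrite /sc /= mulrA ss mul1r.
pose h := g \o sc.
have hL : {morph h : x y /
    Lmul (u * t - 1) (t - 1) (v - 1) (s * w) x y >-> mul x y}.
  case=> al a [be b]; rewrite /h /sc /=; case: (Z2P al) => ->.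
    rewrite g0 add0r lift0; congr (g (_, _)).
    by case: (Z2P be) => -> /=; rewrite ?lift0 ?lift1; ring.
  rewrite lift1; case: (Z2P be) => ->; rewrite ?lift0 ?lift1.
    by rewrite g10 addr0; congr (g (_, _)); ring.
  by rewrite g11; congr (g (_, _)); [exact: val_inj | ring: ss tt].
have [f hK fK] : bijective h := bij_comp bijg (inv_bij scK).
exists f => [|x y]; first by exists h.
by apply: (can_inj hK); rewrite hL !fK.
Qed.

(** * Commutativity, nuclei and associativity *)

Lemma Lmul_commutative (eps theta tau q : 'F_3) :
  eps \in F01 -> tau \in F01 ->
  commutative (Lmul eps theta tau q) <-> eps = tau /\ theta = 0.
Proof.
move=> he hu; split=> [C | [-> ->] [al a] [be b]]; last first.
  by congr (_, _); [exact: addrC | ring].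
(* This pair compares 1 + theta with 1; the next one compares q + eps + 1 with q + tau + 1. *)
have /pair_equal_spec[_] := C (0, 1) (1, 0); rewrite lift0 lift1 => E.
have t0 : theta = 0 by apply/eqP; move: E; case: (F3P theta) => ->.
have /pair_equal_spec[_] := C (1, 1) (1, 0); rewrite t0 lift1 => {}E.
split=> //; apply/eqP; move: E.
by case/F01P: he => ->; case/F01P: hu => ->; case: (F3P q) => ->.
Qed.

Lemma Lmul_left_nuclear (eps theta tau q : 'F_3) : theta \in F01 ->
  left_nuclear (Lmul eps theta tau q) <-> eps = 0.
Proof.
move=> ht; split=> [N | -> c [al a] [be b]].
  (* As (1 + theta)^2 = 1, the two sides are q + eps + 1 and q + 1. *)
  have /pair_equal_spec[_] := N 1 (1, 0) (1, 0); rewrite lift0 lift1 => E.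
  apply/eqP; move: E.
  by case/F01P: ht => ->; case: (F3P eps) => ->; case: (F3P q) => ->;
    case: (F3P tau) => ->.
congr (_, _); first by rewrite addrA.
by rewrite lift_character // add0r lift0; ring.
Qed.

Lemma Lmul_middle_nuclear (eps theta tau q : 'F_3) : theta \in F01 ->
  middle_nuclear (Lmul eps theta tau q) <-> eps = tau.
Proof.
move=> ht; split=> [N | -> c [al a] [be b]].
  (* The two sides differ by (eps - tau)(1 + theta), and 1 + theta is a unit. *)
  have /pair_equal_spec[_] := N 1 (1, 0) (1, 0).
  rewrite lift0 addr0 add0r lift1 => E; apply/eqP; move: E.
  by case/F01P: ht => ->; case: (F3P eps) => ->; case: (F3P q) => ->;
    case: (F3P tau) => ->.
congr (_, _); first by rewrite addrA.
by rewrite lift0 addr0 add0r; ring: (lift_sqr be).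
Qed.

Lemma Lmul_right_nuclear (eps theta tau q : 'F_3) :
  right_nuclear (Lmul eps theta tau q) <-> tau = 0.
Proof.
split=> [N | -> c [al a] [be b]].
  (* The two sides are q + 1 and q + tau + 1. *)
  have /pair_equal_spec[_] := N 1 (1, 0) (1, 0).
  rewrite lift0 addr0 lift1 => E; apply/eqP; move: E.
  by case: (F3P theta) => ->; case: (F3P eps) => ->; case: (F3P q) => ->;
    case: (F3P tau) => ->.
congr (_, _); first by rewrite addrA.
by rewrite lift0 addr0; ring.
Qed.

(** For eps = tau = 0 this is an extension with action 1 + be' theta and factor set al' be' q. When
    theta q = 0 the action fixes the factor set, so the untwisted cocycle identity suffices. *)
Lemma Lmul_group (eps theta tau q : 'F_3) : theta \in F01 ->
  is_group (Lmul eps theta tau q) <-> [/\ eps = 0, tau = 0 & theta * q = 0].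
Proof.
move=> ht; split=> [[e [inv [A _ _ _ _]]] | [-> -> tq]].
  split.
  - by apply/(Lmul_left_nuclear _ _ tau q ht) => c x y; rewrite A.
  - by apply/(Lmul_right_nuclear eps theta _ q) => c x y; rewrite A.
  (* The two bracketings of the cube of (1, 0) give (1 + theta) q and q. *)
  have /pair_equal_spec[_] := A (1, 0) (1, 0) (1, 0).
  have -> : 1 + 1 = 0 :> 'Z_2 by exact: val_inj.
  rewrite lift0 lift1 => E; apply/eqP; move: E.
  by case/F01P: ht => ->; case: (F3P q) => ->; case: (F3P eps) => ->;
    case: (F3P tau) => ->.
have tt : theta * theta = - (theta + theta).
  by case/F01P: ht => ->; apply: val_inj.
(* The inverse solves (al, c)(al, a) = (0, 0) for c, using that 1 + al' theta is its own inverse and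
   theta q = 0. *)
exists (0, 0), (fun x =>
  (x.1, - (lift23 x.1 * q) - (1 + lift23 x.1 * theta) * x.2)).
split=> [[al a] [be b] [ga c] | [al a] | [al a] | [al a] | [al a]];
  congr (_, _) => /=.
- by rewrite addrA.
- by rewrite lift_character //; ring: tq (lift_cocycle al be ga).
- by rewrite add0r.
- by rewrite lift0; ring.
- by rewrite addr0.
- by rewrite lift0; ring.
- by case: (Z2P al) => ->; apply: val_inj.
- by case: (Z2P al) => ->; rewrite ?lift0 ?lift1; ring: tq tt.
- by case: (Z2P al) => ->; apply: val_inj.
- by case: (Z2P al) => ->; rewrite ?lift0 ?lift1; ring: tq.
Qed.

Theorem proposition15 :
  (forall eps theta tau q : 'F_3,
     eps \in F01 -> theta \in F01 -> tau \in F01 -> q \in F01 ->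
     is_Albert_extension (fun al be : 'Z_2 => al + be) 0
                         (fun a b : 'F_3 => a + b) 0
                         (Lmul eps theta tau q))
  /\
  (* (1) *)
  (forall (T : finType) (mul : T -> T -> T) (e : T),
     is_loop mul e -> #|T| = 6%N ->
     (exists H : {set T}, is_subgroup mul e H /\ #|H| = 3%N) ->
     exists eps theta tau q : 'F_3,
       [/\ eps \in F01, theta \in F01, tau \in F01 & q \in F01] /\
       loop_isomorphic mul (Lmul eps theta tau q))
  /\
  (forall eps theta tau q : 'F_3,
     eps \in F01 -> theta \in F01 -> tau \in F01 -> q \in F01 ->
     let L := Lmul eps theta tau q in
     (* (2) *)
     (commutative L <-> eps = tau /\ theta = 0)
     /\
     (* (3) *)
     ((nuclear L \/
       exactly_one (left_nuclear L) (middle_nuclear L) (right_nuclear L))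
      /\ (left_nuclear L <-> eps = 0)
      /\ (middle_nuclear L <-> eps = tau)
      /\ (right_nuclear L <-> tau = 0))
     /\
     (* (4) *)
     (is_group L <-> [/\ eps = 0, tau = 0 & theta * q = 0])).
Proof.
split; [|split].
- by move=> eps theta tau q he ht hu _; exact: Lmul_Albert.
- move=> T mul e lp cT [H [sg cH]]; exact: (order6_loop_Lmul lp cT sg cH).
move=> eps theta tau q he ht hu hq /=.
have lN := Lmul_left_nuclear eps theta tau q ht.
have mN := Lmul_middle_nuclear eps theta tau q ht.
have rN := Lmul_right_nuclear eps theta tau q.
split; first exact: Lmul_commutative.
split; last exact: Lmul_group.
(* The pairs (eps, tau) = (0, 0), (0, 1), (1, 0), (1, 1) are respectively nuclear, only left, only
   right and only middle nuclear. *)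
split=> //; case/F01P: he lN mN rN => ->; case/F01P: hu => -> lN mN rN;
  [left | right; constructor 1 | right; constructor 3 | right; constructor 2];
  by split; rewrite ?lN ?mN ?rN.
Qed.
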